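(* Let $\alpha,\gamma,\theta,\lambda,\beta\in\mathbb{R}$, $h>0$, $\tau>0$, and integers $K\ge 1$, $J\ge 2$. Let $\{u_k^j\}$, $k\in\mathbb{Z}$, $0\le j\le J$, be a complex mesh function that is $K$-periodic in $k$ ($u_{k+K}^j=u_k^j$) and satisfies, for all $k\in\mathbb{Z}$ and all $1\le j\le J-1$, the Preissman multisymplectic scheme $$\begin{aligned} &\tfrac12\big(\delta_t^2u_{k+\frac12}^{j}+\delta_t^2u_{k-\frac12}^{j}\big)-\tfrac12\big(\delta_x^2u_k^{j+\frac12}+\delta_x^2u_k^{j-\frac12}\big)-\tfrac{i\alpha}{2}\big(\delta_{2t}u_{k+\frac12}^{j}+\delta_{2t}u_{k-\frac12}^{j}\big)\\ &-\tfrac{i\theta}{2}\big(\delta_{2x}u_k^{j+\frac12}+\delta_{2x}u_k^{j-\frac12}\big)+\gamma\,\delta_{2t}\delta_{2x}u_k^j+\tfrac{\lambda}{4}\big[u_{k+\frac12}^{j+\frac12}+u_{k-\frac12}^{j+\frac12}+u_{k+\frac12}^{j-\frac12}+u_{k-\frac12}^{j-\frac12}\big]\\ &+\tfrac{\beta}{4}\Big[\big|u_{k+\frac12}^{j+\frac12}\big|^2u_{k+\frac12}^{j+\frac12}+\big|u_{k+\frac12}^{j-\frac12}\big|^2u_{k+\frac12}^{j-\frac12}+\big|u_{k-\frac12}^{j+\frac12}\big|^2u_{k-\frac12}^{j+\frac12}+\big|u_{k-\frac12}^{j-\frac12}\big|^2u_{k-\frac12}^{j-\frac12}\Big]=0.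 \end{aligned}$$ For $0\le j\le J-1$ define the discrete energy $$\mathcal{E}^{j+\frac12}=h\sum_k\Big[\big|\delta_{\hat t}u_{k+\frac12}^{j+\frac12}\big|^2+i\theta\,u_{k+\frac12}^{j+\frac12}\,\delta_{\hat x}\overline{u_{k+\frac12}^{j+\frac12}}+\big|\delta_{\hat x}u_{k+\frac12}^{j+\frac12}\big|^2+\lambda\big|u_{k+\frac12}^{j+\frac12}\big|^2+\frac{\beta}{2}\big|u_{k+\frac12}^{j+\frac12}\big|^4\Big].$$ Then for every $1\le j\le J-1$, $$\mathcal{E}^{j+\frac12}-\mathcal{E}^{j-\frac12}=-\frac{\beta}{2}\,h\sum_k\Big[\big|u_{k+\frac12}^{j+\frac12}\big|^2-\big|u_{k+\frac12}^{j-\frac12}\big|^2\Big]\,\big|\delta_{2t}u_{k+\frac12}^j\big|^2\,\tau^2 .$$ In particular, if $\beta=0$, then $\mathcal{E}^{j+\frac12}=\mathcal{E}^{j-\frac12}=\cdots=\mathcal{E}^{\frac12}$.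
   Context: Here $i^2=-1$, the bar is complex conjugation, and $\sum_k$ is the sum over one period $k=0,1,\dots,K-1$. In the paper $h$ and $\tau$ are the space and time step sizes, and $u_k^j$ approximates a function $u$ at $(x_l+kh,\,j\tau)$. Half-index values are averages: $u_{k+\frac12}^j=\frac12(u_k^j+u_{k+1}^j)$, $u_k^{j+\frac12}=\frac12(u_k^j+u_k^{j+1})$, $u_{k+\frac12}^{j+\frac12}=\frac14(u_k^j+u_{k+1}^j+u_k^{j+1}+u_{k+1}^{j+1})$. Difference operators (applied, with the obvious meaning, at integer or half-integer positions in the other variable): $\delta_t^2u_k^j=\frac{u_k^{j+1}-2u_k^j+u_k^{j-1}}{\tau^2}$, $\delta_x^2u_k^j=\frac{u_{k+1}^j-2u_k^j+u_{k-1}^j}{h^2}$, $\delta_{2t}u_k^j=\frac{u_k^{j+1}-u_k^{j-1}}{2\tau}$, $\delta_{2x}u_k^j=\frac{u_{k+1}^j-u_{k-1}^j}{2h}$, $\delta_{\hat t}u_k^{j+\frac12}=\frac{u_k^{j+1}-u_k^j}{\tau}$, $\delta_{\hat x}u_{k+\frac12}^j=\frac{u_{k+1}^j-u_k^j}{h}$. Thus $\delta_{\hat t}u_{k+\frac12}^{j+\frac12}=\frac{u_{k+\frac12}^{j+1}-u_{k+\frac12}^j}{\tau}$ and $\delta_{\hat x}u_{k+\frac12}^{j+\frac12}=\frac{u_{k+1}^{j+\frac12}-u_k^{j+\frac12}}{h}$. *)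

(* Defs.v *)
From HB Require Import structures.
From mathcomp Require Import all_boot all_order all_algebra.
From mathcomp Require Import reals complex.

Set Implicit Arguments.
Unset Strict Implicit.
Unset Printing Implicit Defensive.

Import Order.TTheory GRing.Theory Num.Theory.
Local Open Scope ring_scope.
Local Open Scope complex_scope.

(* [u k j] is the value of the mesh function at space index k, time index j.
   A quantity living at half-integer positions is again a [mesh R], indexed by
   the integer part: its value at (k + 1/2, j), (k, j + 1/2) or
   (k + 1/2, j + 1/2) is stored at [k j].  Hence position k - 1/2 is index
   [k - 1], and position j - 1/2 is index [j - 1]. *)
Definition mesh (R : realType) : Type := int -> int -> R[i].

Section Operators.
Variable R : realType.
Implicit Types (u v : mesh R) (h tau : R).

(* value at (k + 1/2, j) *)
Definition avgx u : mesh R := fun k j => (u k j + u (k + 1) j) / 2.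

(* value at (k, j + 1/2) *)
Definition avgt u : mesh R := fun k j => (u k j + u k (j + 1)) / 2.

(* value at (k + 1/2, j + 1/2) *)
Definition avgxt u : mesh R := fun k j =>
  (u k j + u (k + 1) j + u k (j + 1) + u (k + 1) (j + 1)) / 4.

Definition conj_mesh u : mesh R := fun k j => (u k j)^*.

Definition dt2 tau v : mesh R := fun k j =>
  (v k (j + 1) - 2 * v k j + v k (j - 1)) / tau%:C ^+ 2.

Definition dx2 h v : mesh R := fun k j =>
  (v (k + 1) j - 2 * v k j + v (k - 1) j) / h%:C ^+ 2.

Definition d2t tau v : mesh R := fun k j =>
  (v k (j + 1) - v k (j - 1)) / (2 * tau%:C).

Definition d2x h v : mesh R := fun k j =>
  (v (k + 1) j - v (k - 1) j) / (2 * h%:C).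

(* value at time position j + 1/2 *)
Definition dht tau v : mesh R := fun k j => (v k (j + 1) - v k j) / tau%:C.

(* value at space position k + 1/2 *)
Definition dhx h v : mesh R := fun k j => (v (k + 1) j - v k j) / h%:C.

Definition cubic (z : R[i]) : R[i] := `|z| ^+ 2 * z.

(* left-hand side of the Preissman scheme at (k, j) *)
Definition preissman (alpha gamma theta lambda beta h tau : R) u (k j : int)
    : R[i] :=
  (dt2 tau (avgx u) k j + dt2 tau (avgx u) (k - 1) j) / 2
  - (dx2 h (avgt u) k j + dx2 h (avgt u) k (j - 1)) / 2
  - 'i%C * alpha%:C / 2 * (d2t tau (avgx u) k j + d2t tau (avgx u) (k - 1) j)
  - 'i%C * theta%:C / 2 * (d2x h (avgt u) k j + d2x h (avgt u) k (j - 1))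
  + gamma%:C * d2t tau (d2x h u) k j
  + lambda%:C / 4 * (avgxt u k j + avgxt u (k - 1) j
                     + avgxt u k (j - 1) + avgxt u (k - 1) (j - 1))
  + beta%:C / 4 * (cubic (avgxt u k j) + cubic (avgxt u k (j - 1))
                   + cubic (avgxt u (k - 1) j)
                   + cubic (avgxt u (k - 1) (j - 1))).

(* discrete energy at time position j + 1/2; the modulus [`| z |] and hence the
   energy are R[i]-valued *)
Definition energy (theta lambda beta h tau : R) (K : nat) u (j : int) : R[i] :=
  h%:C * \sum_(0 <= k < K)
    (`|dht tau (avgx u) k j| ^+ 2
     + 'i%C * theta%:C * avgxt u k j * dhx h (conj_mesh (avgt u)) k j
     + `|dhx h (avgt u) k j| ^+ 2
     + lambda%:C * `|avgxt u k j| ^+ 2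
     + beta%:C / 2 * `|avgxt u k j| ^+ 4).

End Operators.

(* Main.v *)
(* The scheme at node k reads A_k + A_(k-1) + B_k - B_(k-1) = 0, where A is the
   box average of the time-difference and potential terms and B a numerical flux
   of the spatial differences.  Pairing it with the conjugate of the centred time
   difference w and summing by parts over a period turns it into
   sum_k [A_k conj(w_k + w_(k+1)) + B_k conj(w_k - w_(k+1))] = 0, whose real part
   is the energy increment: the alpha and gamma terms are imaginary up to
   telescoping, and the quadratic terms give exact differences.  With S, S' the
   squared moduli of the cell averages s, s' at j + 1/2 and j - 1/2, the cubic
   term leaves the defect beta/2 (S - S') |s - s'|^2, where
   |s - s'|^2 = tau^2 |d2t (avgx u)|^2. *)
Require Import Defs.
From HB Require Import structures.
From mathcomp Require Import all_boot all_order all_algebra.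
From mathcomp Require Import reals complex zify ring.
Import Order.TTheory GRing.Theory Num.Theory.
Local Open Scope ring_scope.
Local Open Scope complex_scope.

Section ComplexConjugation.
Variable R : realType.
Implicit Types x y : R[i].

(* [^*] is parsed as [conjc] or as [Num.conj] depending on the scope on top of
   the stack; the two are convertible but block each other's rewrite rules. *)
Lemma conjc_conj x : conjc x = Num.conj x.
Proof. by []. Qed.

Lemma conj_real (a : R) : Num.conj (a%:C : R[i]) = a%:C.
Proof. exact: conjc_real. Qed.

Lemma conj_i : Num.conj ('i%C : R[i]) = - 'i%C.
Proof. by apply/eqP; rewrite eq_complex /= oppr0 !eqxx. Qed.

Lemma conjD x y : Num.conj (x + y) = Num.conj x + Num.conj y.
Proof. exact: rmorphD. Qed.

Lemma conjN x : Num.conj (- x) = - Num.conj x.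
Proof. exact: rmorphN. Qed.

Lemma conjM x y : Num.conj (x * y) = Num.conj x * Num.conj y.
Proof. exact: rmorphM. Qed.

Lemma conjX x n : Num.conj (x ^+ n) = Num.conj x ^+ n.
Proof. exact: rmorphXn. Qed.

Lemma conjV x : Num.conj (x^-1) = (Num.conj x)^-1.
Proof. exact: fmorphV. Qed.

Lemma conj_nat n : Num.conj (n%:R : R[i]) = n%:R.
Proof. exact: rmorph_nat. Qed.

(* [conj_nat] comes before [conjD] because numerals unify with sums of ones. *)
Definition conjE :=
  (conj_real, conj_nat, conj_i, @conjCK R[i], conjD, conjN, conjM, conjX, conjV).

End ComplexConjugation.

Section EnergyBalance.
Variables (R : realType) (alpha gamma theta lambda beta h tau : R) (u : mesh R).
Hypotheses (h_gt0 : 0 < h) (tau_gt0 : 0 < tau).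
Implicit Types k j : int.

Definition box k j : R[i] :=
  dt2 tau (avgx u) k j / 2 - 'i%C * alpha%:C / 2 * d2t tau (avgx u) k j
  + lambda%:C / 4 * (avgxt u k j + avgxt u k (j - 1))
  + beta%:C / 4 * (cubic (avgxt u k j) + cubic (avgxt u k (j - 1))).

Definition flux k j : R[i] :=
  - (dhx h (avgt u) k j + dhx h (avgt u) k (j - 1)) / (2 * h%:C)
  - 'i%C * theta%:C / (2 * h%:C) * (avgxt u k j + avgxt u k (j - 1))
  + gamma%:C / h%:C * avgx (d2t tau u) k j.

Lemma real_complex_neq0 (x : R) : 0 < x -> x%:C != 0.
Proof. by move=> x_gt0; rewrite fmorph_eq0 gt_eqF. Qed.

(** Each spatial difference is a backward difference in [k] of a half-point quantity: [dx2] comes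
    from [dhx], and [d2x] from a spatial average. *)
Lemma preissman_boxE k j :
  preissman alpha gamma theta lambda beta h tau u k j
  = box k j + box (k - 1) j + flux k j - flux (k - 1) j.
Proof.
have h_neq0 := real_complex_neq0 _ h_gt0.
have tau_neq0 := real_complex_neq0 _ tau_gt0.
rewrite /preissman /box /flux.
move: (cubic (avgxt u k j)) (cubic (avgxt u k (j - 1)))
  (cubic (avgxt u (k - 1) j)) (cubic (avgxt u (k - 1) (j - 1))) => c1 c2 c3 c4.
rewrite /dt2 /dx2 /d2t /d2x /dhx /avgxt /avgt /avgx !subrK.
by field; rewrite ?h_neq0 ?tau_neq0.
Qed.

Definition energy_density k j : R[i] :=
  `|dht tau (avgx u) k j| ^+ 2
  + 'i%C * theta%:C * avgxt u k j * dhx h (conj_mesh (avgt u)) k j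
  + `|dhx h (avgt u) k j| ^+ 2
  + lambda%:C * `|avgxt u k j| ^+ 2
  + beta%:C / 2 * `|avgxt u k j| ^+ 4.

(* The part of the energy increment that telescopes in k even off the scheme. *)
Definition gauge k j : R[i] :=
  let v := avgt u k j in let v' := avgt u k (j - 1) in let w := d2t tau u k j in
  'i%C * theta%:C / (2 * h%:C) * (v - v') * (v + v')^*%R
  + tau%:C * gamma%:C / h%:C * (w * w^*%R).


(** A pointwise algebraic identity, valid for every mesh function; the scheme enters only
    afterwards. *)
Lemma energy_density_balance k j :
  energy_density k j - energy_density k (j - 1)
  + beta%:C / 2 * ((`|avgxt u k j| ^+ 2 - `|avgxt u k (j - 1)| ^+ 2)
                   * `|d2t tau (avgx u) k j| ^+ 2 * tau%:C ^+ 2)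
  = tau%:C *
      (box k j * (d2t tau u k j + d2t tau u (k + 1) j)^*%R
       + flux k j * (d2t tau u k j - d2t tau u (k + 1) j)^*%R
       + (box k j * (d2t tau u k j + d2t tau u (k + 1) j)^*%R
          + flux k j * (d2t tau u k j - d2t tau u (k + 1) j)^*%R)^*%R)
    + gauge (k + 1) j - gauge k j.
Proof.
have h_neq0 := real_complex_neq0 _ h_gt0.
have tau_neq0 := real_complex_neq0 _ tau_gt0.
rewrite /energy_density /gauge /box /flux /cubic.
rewrite !(exprM _ 2 2) !normCK.
rewrite /conj_mesh /dt2 /dx2 /d2t /d2x /dht /dhx /avgxt /avgt /avgx !subrK.
rewrite !conjc_conj !conjE.
move: (u k j) (u (k + 1) j) (u k (j + 1)) (u (k + 1) (j + 1)) (u k (j - 1))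
  (u (k + 1) (j - 1)) => u1 u2 u3 u4 u5 u6.
(* The six values and their conjugates become twelve independent variables of a rational
   identity. *)
move: (Num.conj u1) (Num.conj u2) (Num.conj u3) (Num.conj u4) (Num.conj u5)
  (Num.conj u6) => v1 v2 v3 v4 v5 v6.
by field; rewrite ?h_neq0 ?tau_neq0.
Qed.

Definition box_flux k j : R[i] :=
  (box (k - 1) j - flux (k - 1) j) * (d2t tau u k j)^*%R.

Definition energy_flux k j : R[i] :=
  tau%:C * (box_flux k j + (box_flux k j)^*%R) + gauge k j.

Lemma energy_density_flux k j :
  preissman alpha gamma theta lambda beta h tau u k j = 0 ->
  energy_density k j - energy_density k (j - 1)
  = - (beta%:C / 2) *
      ((`|avgxt u k j| ^+ 2 - `|avgxt u k (j - 1)| ^+ 2)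
       * `|d2t tau (avgx u) k j| ^+ 2 * tau%:C ^+ 2)
    + (energy_flux (k + 1) j - energy_flux k j).
Proof.
rewrite preissman_boxE => /eqP; rewrite subr_eq0 => /eqP scheme.
have := energy_density_balance k j.
have -> : box k j * (d2t tau u k j + d2t tau u (k + 1) j)^*%R
          + flux k j * (d2t tau u k j - d2t tau u (k + 1) j)^*%R
          = box_flux (k + 1) j - box_flux k j.
  (* By the scheme, [box (k - 1) j - flux (k - 1) j] equals [- (box k j + flux k j)]. *)
  rewrite /box_flux addrK conjD -[in RHS]scheme
    (conjD R (d2t _ _ _ _)) conjN.
  ring.
rewrite /energy_flux (conjD R (box_flux _ _)) conjN mulNr.
move=> /(canRL (addrK _)) ->.
ring.
Qed.

Section Periodic.
Variables (K : nat) (j : int).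
Hypothesis u_periodic :
  forall k i, j - 1 <= i <= j + 1 -> u (k + K%:Z) i = u k i.

(** Only the time levels [j - 1], [j], [j + 1] enter, all within the mesh when [j] is interior. *)
Lemma energy_flux_periodic k : energy_flux (k + K%:Z) j = energy_flux k j.
Proof.
have up0 l : u (l + K%:Z) j = u l j by apply: u_periodic; lia.
have upS l : u (l + K%:Z) (j + 1) = u l (j + 1) by apply: u_periodic; lia.
have upP l : u (l + K%:Z) (j - 1) = u l (j - 1) by apply: u_periodic; lia.
rewrite /energy_flux /gauge /box_flux /box /flux /cubic.
rewrite /dt2 /d2t /dhx /avgxt /avgt /avgx !subrK.
by rewrite !(addrAC _ K%:Z) !(up0, upS, upP).
Qed.

Lemma energy_balance :
  (forall k, preissman alpha gamma theta lambda beta h tau u k j = 0) ->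
  energy theta lambda beta h tau K u j
    - energy theta lambda beta h tau K u (j - 1)
  = - (beta%:C / 2) * h%:C *
      (\sum_(0 <= k < K)
         (`|avgxt u k%:Z j| ^+ 2 - `|avgxt u k%:Z (j - 1)| ^+ 2)
         * `|d2t tau (avgx u) k%:Z j| ^+ 2 * tau%:C ^+ 2).
Proof.
move=> scheme; rewrite /energy -mulrBr -sumrB.
under eq_bigr => k _ do rewrite (energy_density_flux _ _ (scheme k)).
rewrite big_split /= -mulr_sumr.
have -> : \sum_(0 <= k < K) (energy_flux (k%:Z + 1) j - energy_flux k%:Z j) = 0.
  (* The sum collapses to the flux at [K] minus the flux at 0, which agree by periodicity. *)
  rewrite (telescope_sumr_eq (fun k : nat => energy_flux k%:Z j)) //.
    by rewrite -[K%:Z]add0r energy_flux_periodic subrr.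
  by move=> k _; rewrite -addn1 PoszD.
by rewrite addr0 mulrA [h%:C * _]mulrC.
Qed.

End Periodic.
End EnergyBalance.


Theorem theorem1 (R : realType) (alpha gamma theta lambda beta h tau : R)
    (K J : nat) (u : mesh R)
    (h_gt0 : 0 < h) (tau_gt0 : 0 < tau) (K_ge1 : (1 <= K)%N) (J_ge2 : (2 <= J)%N)
    (u_periodic : forall k j : int, 0 <= j <= J%:Z -> u (k + K%:Z) j = u k j)
    (u_scheme : forall k j : int, 1 <= j <= J%:Z - 1 ->
       preissman alpha gamma theta lambda beta h tau u k j = 0) :
  (forall j : int, 1 <= j <= J%:Z - 1 ->
     energy theta lambda beta h tau K u j
       - energy theta lambda beta h tau K u (j - 1)
     = - (beta%:C / 2) * h%:C *
         (\sum_(0 <= k < K)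
            (`|avgxt u k%:Z j| ^+ 2 - `|avgxt u k%:Z (j - 1)| ^+ 2)
            * `|d2t tau (avgx u) k%:Z j| ^+ 2 * tau%:C ^+ 2))
  /\ (beta = 0 -> forall j : int, 1 <= j <= J%:Z - 1 ->
        forall m : int, 0 <= m <= j ->
        energy theta lambda beta h tau K u j
          = energy theta lambda beta h tau K u m).
Proof.
have balance (j : int) (hj : 1 <= j <= J%:Z - 1) := energy_balance
  R alpha gamma theta lambda beta h tau u h_gt0 tau_gt0 K j
  (fun k i hi => u_periodic k i ltac:(lia)) (fun k => u_scheme k j hj).
split=> [//|beta0 j hj m hm].
(* Induction on the number of time steps above [m]; with [beta = 0] each step has zero increment. *)
have step (n : nat) : m + n%:Z <= j ->
    energy theta lambda beta h tau K u (m + n%:Z)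
    = energy theta lambda beta h tau K u m.
  elim: n => [|n IHn] hn; first by rewrite addr0.
  have hn1 : 1 <= m + n.+1%:Z <= J%:Z - 1 by lia.
  have := balance _ hn1.
  have -> : m + n.+1%:Z - 1 = m + n%:Z by lia.
  rewrite IHn; last by lia.
  by rewrite beta0 !mul0r oppr0 !mul0r => /eqP; rewrite subr_eq0 => /eqP.
have -> : j = m + `|j - m|%N%:Z by lia.
by apply: step; lia.
Qed.
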